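(* Let $f$ and $g$ be polynomial vector fields on $\mathbb C^2$ such that the polynomial $\theta:=\det(f,g)$ is not identically zero, and let $$\beta:=-\left(\frac{X_f(\theta)}{\theta}-\operatorname{div} f\right),$$ a rational function on $\mathbb C^2$. Let $$\det(f,g)=\theta=\sigma_1^{m_1}\cdots\sigma_r^{m_r}$$ be the prime factorization, with pairwise relatively prime $\sigma_i$, $1\le i\le r$, and denote the zero set of $\sigma_i$ by $Y_i$. Let $j\in\{1,\ldots,r\}$. Then $\beta$ is regular at some point of $Y_j\setminus\bigcup_{i\neq j}Y_i$ if and only if $Y_j$ is invariant for $\dot x=f(x)$.
   Context: For a vector field $f$, $X_f(\psi)(x)=D\psi(x)f(x)$ for scalar-valued functions $\psi$, and $\operatorname{div} f$ is the divergence. $\det(f,g)(x)$ is the determinant of the $2\times2$ matrix with columns $f(x),g(x)$. A rational function is regular at a point if it can be written as a quotient of polynomials whose denominator does not vanish at that point. A set is invariant for $\dot x=f(x)$ if every solution starting in it remains in it as long as it exists. (With $\alpha:=X_g(\theta)/\theta-\operatorname{div} g$ and $[g,f](x)=Df(x)g(x)-Dg(x)f(x)$, one has the identity $[g,f]=\alpha f+\beta g$ wherever $\theta\ne0$.) *)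

(* Defs.v *)
(* MathComp / MathComp-Analysis, with multinomials for polynomials.
   Only the canonical instances of mpoly are imported, as its notations clash
   with those of analysis. *)
From HB Require Import structures.
From mathcomp Require Import all_boot all_order all_algebra.
From mathcomp Require Import complex.
From mathcomp Require mpoly.
From mathcomp Require Import all_classical all_reals all_analysis.

Set Implicit Arguments.
Unset Strict Implicit.
Unset Printing Implicit Defensive.

Import GRing.Theory Num.Theory.
Import numFieldNormedType.Exports.
Import (canonicals) mpoly.

Local Open Scope classical_set_scope.
Local Open Scope ring_scope.

Notation "{ 'mpoly' T [ n ] }" := (mpoly.mpoly n T)
  (at level 0, T at level 2, format "{ 'mpoly'  T [ n ] }") : type_scope.
Notation "p .@[ v ]" := (mpoly.meval v p)
  (at level 1, left associativity, format "p .@[ v ]") : ring_scope.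

Section Divisibility.
Variable A : idomainType.
Implicit Types a b p : A.

Definition divides a b := exists c, b = a * c.

Definition prime_element p :=
  [/\ p != 0, p \isn't a GRing.unit &
      forall a b, divides p (a * b) -> divides p a \/ divides p b].

Definition relatively_prime a b :=
  forall d, divides d a -> divides d b -> d \is a GRing.unit.

End Divisibility.

Section PolynomialVectorFields.
Variables (K : fieldType) (n : nat).

Definition vfield := 'cV[{mpoly K[n]}]_n.

Implicit Types (f : vfield) (p : {mpoly K[n]}) (q : {fraction {mpoly K[n]}}).

Definition lie_derivative f p : {mpoly K[n]} :=
  \sum_(i < n) mpoly.mderiv i p * f i 0.

Definition divergence f : {mpoly K[n]} := \sum_(i < n) mpoly.mderiv i (f i 0).

Definition zero_set p : set ('I_n -> K) := [set v | p.@[v] = 0].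

Definition regular_at q (v : 'I_n -> K) :=
  exists a b : {mpoly K[n]}, b.@[v] != 0 /\ q = tofrac a / tofrac b.

End PolynomialVectorFields.

Definition det_vf (K : fieldType) (f g : vfield K 2) : {mpoly K[2]} :=
  \det (row_mx f g : 'M[{mpoly K[2]}]_2).

Definition beta (K : fieldType) (f g : vfield K 2) :
    {fraction {mpoly K[2]}} :=
  let theta := det_vf f g in
  - (tofrac (lie_derivative f theta) / tofrac theta - tofrac (divergence f)).

Section Invariance.
Variables (R : realType) (n : nat).

(* Time is real: the derivative of the curve x : R -> C^n is taken on the real
   and imaginary parts of its coordinates. *)
Definition is_solution (f : vfield R[i] n) (I : set R)
    (x : R -> 'I_n -> R[i]) :=
  forall t, I t -> forall i : 'I_n,
    is_derive t (1 : R) (fun s => complex.Re (x s i))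
      (complex.Re (f i 0).@[x t]) /\
    is_derive t (1 : R) (fun s => complex.Im (x s i))
      (complex.Im (f i 0).@[x t]).

(* Solutions on every open interval around the initial time 0 are considered;
   as the equation is autonomous, the choice of initial time is immaterial. *)
Definition invariant_set (f : vfield R[i] n) (Y : set ('I_n -> R[i])) :=
  forall (I : set R) (x : R -> 'I_n -> R[i]),
    open I -> is_interval I -> I 0 -> is_solution f I x ->
    Y (x 0) -> forall t, I t -> Y (x t).

End Invariance.

(* Main.v *)
From HB Require Import structures.
Require Import Defs.
From mathcomp Require Import all_boot all_order all_algebra.
From mathcomp Require Import complex.
From mathcomp Require mpoly.
From mathcomp Require Import zify ring lra.
From mathcomp Require Import all_classical all_reals all_analysis.

Import (canonicals) mpoly.
Import Order.TTheory GRing.Theory Num.Theory.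
Import numFieldNormedType.Exports.

Set Implicit Arguments.
Unset Strict Implicit.
Unset Printing Implicit Defensive.

Local Open Scope classical_set_scope.
Local Open Scope ring_scope.

(** Write theta = s^m t, where s is the factor defining the curve under study
    and t collects the other prime powers.  Since X_f is a derivation,
    X_f(theta)/theta = m X_f(s)/s + X_f(t)/t, so at a zero of s where t does not
    vanish the only possible pole of beta comes from X_f(s)/s.  As s is prime,
    this pole is absent exactly when s divides X_f(s), a condition that no
    longer mentions the point ([regular_logarithmic_derivative]).  A zero of s
    where t does not vanish always exists: otherwise t would vanish on the
    hypersurface s = 0, and the Nullstellensatz for a prime hypersurface
    ([prime_hypersurface_null]) would make s divide t, against coprimality.

    It remains to see that the zero set of s is invariant if and only if s
    divides X_f(s) ([prime_invariantP]); this holds in any number of variables.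

    If X_f(s) = s c, then along a solution x the function y = s(x) solves the
    linear equation y' = c(x) y.  A Gronwall estimate for |y|^2 shows that y
    vanishes throughout as soon as it vanishes at time 0
    ([divides_invariant]).

    Conversely, let the zero set be invariant.  Through each of its points v
    there is a solution, along which s is identically 0, so the derivative
    X_f(s)(v) of s(x) at time 0 is 0; the Nullstellensatz then gives
    divisibility.  The solution is built as a Lie series: the formula
    phi_t(p) = sum over k of t^k/k! (X_f^k p)(v) converges for small t because
    |(X_f^k p)(v)| grows at most like k! M^k with M independent of p
    ([iter_lie_derivative_bound]).  The Leibniz rule and the Cauchy product of
    series make p |-> phi_t(p) a ring morphism, and termwise differentiation
    gives d/dt phi_t(p) = phi_t(X_f p).  Hence the curve whose coordinates are
    the phi_t of the variables satisfies x' = f(x) ([local_solution]).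

    The Nullstellensatz itself is proved by induction on the number of
    variables.  When the prime p really involves the last variable and does not
    divide q, a resultant produces a nonzero d = U p + V q free of that
    variable; specializing the other variables where neither d nor the leading
    coefficient of p vanishes leaves a common zero of p and q at which d does
    not vanish, a contradiction. *)

(** * Divisibility by a prime element *)

Section Divides.
Variable A : idomainType.
Implicit Types a b p : A.

Lemma divides_refl a : divides a a. Proof. by exists 1; rewrite mulr1. Qed.

Lemma prime_element_prod p (I : Type) (s : seq I) (P : pred I) (F : I -> A) :
  prime_element p -> divides p (\prod_(i <- s | P i) F i) ->
  exists2 i, P i & divides p (F i).
Proof.
move=> [_ pU pP]; elim: s => [|i s IHs].
  by rewrite big_nil => -[c /esym pc]; case/negP: pU; apply/unitrPr; exists c.
rewrite big_cons; case: ifP => // Pi /pP[]; last exact: IHs.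
by exists i.
Qed.

Lemma prime_elementX p a k : prime_element p -> divides p (a ^+ k) -> divides p a.
Proof.
move=> pP; rewrite -(card_ord k) -prodr_const.
by case/(prime_element_prod pP).
Qed.
End Divides.

Lemma prime_element_iso (A B : idomainType) (h : {rmorphism A -> B})
    (k : {rmorphism B -> A}) (p : A) :
  cancel h k -> cancel k h -> prime_element p -> prime_element (h p).
Proof.
move=> hK kK [p0 pU pP]; split.
- by apply: contra p0 => /eqP hp0; rewrite -(hK p) hp0 rmorph0.
- by apply: contra pU => /(rmorph_unit k); rewrite hK.
- move=> a b [c abE].
  have /pP : divides p (k a * k b).
    by exists (k c); rewrite -rmorphM abE rmorphM hK.
  by case=> -[d dE]; [left|right]; exists (h d); rewrite -rmorphM -dE kK.
Qed.

Lemma rmorph_bezout (A B : pzRingType) (h : {rmorphism A -> B}) (d U P V Q : A) :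
  d = U * P + V * Q -> h P = 0 -> h Q = 0 -> h d = 0.
Proof. by move=> -> hP hQ; rewrite rmorphD !rmorphM hP hQ !mulr0 addr0. Qed.

(** Unless Q is constant, d is the resultant of P and Q.  If it vanished, the
    pseudo-gcd G of P and Q would have positive degree; a nonzero multiple c P
    is a product S G, and P can divide neither S, by degree, nor G, since it
    would then divide Q.  Working up to scalars in this way replaces the passage
    to the fraction field and the Gauss lemma. *)
Lemma prime_bezout_const (A : idomainType) (P Q : {poly A}) :
  prime_element P -> (1 < size P)%N -> ~ divides P Q ->
  exists2 d : A, d != 0 & exists U V, d%:P = U * P + V * Q.
Proof.
move=> [P0 _ primeP] sP ndPQ.
(* P has positive degree, so it divides no nonzero constant. *)
have ndC (c : A) (S : {poly A}) : c != 0 -> divides P (c%:P * S) -> divides P S.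
  move=> c0 /primeP[[S' cE]|//].
  have S'0 : S' != 0 by apply: contra_eq_neq cE => ->; rewrite mulr0 polyC_eq0.
  have : (size (P * S')%R <= 1)%N by rewrite -cE size_polyC leq_b1.
  rewrite size_mul //; move: sP S'0; rewrite -size_poly_gt0; lia.
case: (ltnP 1 (size Q)) => sQ; last first.
  have QE := size1_polyC sQ; exists Q`_0.
    apply/eqP => Q00; apply: ndPQ; exists 0; rewrite mulr0 QE Q00 //.
  by exists 0, 1; rewrite mul0r add0r mul1r.
have [[U V] /= _ rE] := resultant_in_ideal sP sQ.
exists (resultant P Q); last by exists U, V.
apply/negP; rewrite resultant_eq0 => sG.
have /Pdiv.Idomain.dvdpP[[c S] /= c0 cP] := dvdp_gcdl P Q.
have /Pdiv.Idomain.dvdpP[[c' S'] /= c'0 cQ] := dvdp_gcdr P Q.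
have [] := primeP S (gcdp P Q).
- by exists c%:P; rewrite -cP mulrC mul_polyC.
- move=> [T ST]; move: cP; rewrite ST -mul_polyC mulrC -mulrA.
  move/(mulfI P0) => cE; have : (size (T * gcdp P Q)%R <= 1)%N by rewrite -cE size_polyC leq_b1.
  have T0 : T != 0 by apply: contra_eq_neq cE => ->; rewrite mul0r polyC_eq0.
  have G0 : gcdp P Q != 0 by rewrite -size_poly_gt0 ltnW.
  by rewrite size_mul //; move: T0 G0 sG; rewrite -!size_poly_gt0; lia.
- move=> [T GT]; apply: ndPQ; apply: (ndC c') => //.
  by exists (S' * T); rewrite mul_polyC cQ GT mulrCA.
Qed.

(** * Polynomials that vanish on a prime hypersurface *)

Section LastVariable.
Variables (n : nat).

Definition extend_point (K : Type) (v : 'I_n -> K) (y : K) : 'I_n.+1 -> K :=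
  fun i => oapp v y (insub (i : nat)).

Lemma extend_point_max K (v : 'I_n -> K) y : extend_point v y ord_max = y.
Proof. by rewrite /extend_point insubF //= ltnn. Qed.

Lemma extend_point_widen K (v : 'I_n -> K) y i :
  extend_point v y (widen_ord (leqnSn n) i) = v i.
Proof.
rewrite /extend_point insubT //= => h; congr v; exact/val_inj.
Qed.

Lemma meval_muni (K : comNzRingType) (p : {mpoly K[n.+1]}) v y :
  p.@[extend_point v y] = (map_poly (mpoly.meval v) (mpoly.muni p)).[y].
Proof.
rewrite mpoly.muniE mpoly.mevalE rmorph_sum /= horner_sum.
apply: eq_bigr => m _; rewrite map_polyZ hornerZ /= map_polyXn hornerXn.
rewrite mpoly.mevalZ mpoly.mevalX big_ord_recr /= extend_point_max mulrA.
congr (_ * _ * _); apply: eq_bigr => i _.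
by rewrite extend_point_widen mpoly.mnmE.
Qed.

(** The inverse of [mpoly.muni], written as a composition of ring morphisms so
    that it is a ring morphism by inference. *)
Definition multi_of_uni (K : comNzRingType) : {poly {mpoly K[n]}} -> {mpoly K[n.+1]} :=
  horner_eval (mpoly.mpolyX K (mpoly.mnm1 ord_max)) \o map_poly (@mpoly.mwiden n K).

HB.instance Definition _ (K : comNzRingType) :=
  GRing.RMorphism.copy (@multi_of_uni K)
    (horner_eval (mpoly.mpolyX K (mpoly.mnm1 ord_max))
       \o map_poly (@mpoly.mwiden n K)).

Lemma muniK (K : comNzRingType) : cancel (@mpoly.muni n K) (@multi_of_uni K).
Proof.
move=> p; rewrite mpoly.muniE /multi_of_uni /= !rmorph_sum /= [RHS]mpoly.mpolyE.
apply: eq_bigr => m _.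
rewrite map_polyZ map_polyXn /horner_eval hornerZ hornerXn /=.
rewrite mpoly.mwidenZ -scalerAl.
congr (_ *: _); rewrite mpoly.mwidenX mpoly.mpolyXn -mpoly.mpolyXD; congr mpoly.mpolyX.
apply/mpoly.mnmP => i; rewrite mpoly.mnmDE mpoly.mulmnE mpoly.mnm1E.
case: (unliftP ord_max i) => [k ->|->]; last first.
  by rewrite mpoly.mnmwiden_ordmax eqxx mul1n.
have -> : lift ord_max k = widen_ord (leqnSn n) k.
  by apply: val_inj; rewrite /= /bump leqNgt ltn_ord.
rewrite mpoly.mnmwiden_widen mpoly.mnmE -val_eqE /= gtn_eqF ?ltn_ord //.
by rewrite mul0n addn0.
Qed.

Lemma muniX (K : comNzRingType) m :
  mpoly.muni (mpoly.mpolyX K m) =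
    mpoly.mpolyX K (mpoly.Multinom [tuple mpoly.fun_of_multinom m (widen_ord (leqnSn n) i) | i < n])
      *: 'X^(mpoly.fun_of_multinom m ord_max).
Proof.
by rewrite mpoly.muniE mpoly.msuppX big_seq1 mpoly.mcoeffX eqxx scale1r.
Qed.

Lemma muni_mwiden (K : comNzRingType) (c : {mpoly K[n]}) :
  mpoly.muni (mpoly.mwiden c) = c%:P.
Proof.
rewrite [in LHS](mpoly.mpolyE c) [in RHS](mpoly.mpolyE c).
rewrite (raddf_sum (@mpoly.mwiden n K)) (raddf_sum (@mpoly.muni n K)) raddf_sum /=.
apply: eq_bigr => m _; rewrite mpoly.mwidenZ mpoly.mwidenX mpoly.muniZ muniX.
rewrite mpoly.mnmwiden_ordmax expr0 alg_polyC -mul_polyC -polyCM mpoly.mul_mpolyC.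
congr ((_ *: mpoly.mpolyX _ _)%:P).
by apply/mpoly.mnmP => i; rewrite mpoly.mnmE mpoly.mnmwiden_widen.
Qed.

Lemma multi_of_uniK (K : comNzRingType) :
  cancel (@multi_of_uni K) (@mpoly.muni n K).
Proof.
move=> q; rewrite /multi_of_uni /= /horner_eval horner_poly rmorph_sum /=.
rewrite -[RHS]coefK poly_def; apply: eq_bigr => i _.
rewrite rmorphM rmorphXn /= muniX mpoly.mnm1E eqxx expr1 muni_mwiden.
rewrite (_ : mpoly.Multinom _ = mpoly.mnm0) ?mpoly.mpolyX0 ?scale1r ?mul_polyC //.
apply/mpoly.mnmP => k; rewrite mpoly.mnmE mpoly.mnm1E mpoly.mnm0E -val_eqE /=.
by rewrite gtn_eqF.
Qed.

End LastVariable.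

Lemma mpoly_dim0 (K : comNzRingType) (p : {mpoly K[0]}) :
  p = mpoly.mpolyC 0 (mpoly.mcoeff mpoly.mnm0 p).
Proof.
apply/mpoly.mpolyP => m; rewrite mpoly.mcoeffC.
by rewrite (_ : m = mpoly.mnm0) ?eqxx ?mulr1 //; apply/mpoly.mnmP => -[].
Qed.

Lemma mpoly_nonvanishing (K : closedFieldType) n (p : {mpoly K[n]}) :
  p != 0 -> exists v, p.@[v] != 0.
Proof.
elim: n p => [|n IHn] p p0.
  exists (fun _ => 0); apply: contra p0 => /eqP pv.
  by rewrite (mpoly_dim0 p) mpoly.mevalC in pv *; rewrite pv.
have P0 : mpoly.muni p != 0 by rewrite (can2_eq (@muniK n K) (@multi_of_uniK n K)) rmorph0.
have [v vP] : exists v, (lead_coef (mpoly.muni p)).@[v] != 0.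
  by apply: IHn; rewrite lead_coef_eq0.
have /closed_nonrootP[y yP] : map_poly (mpoly.meval v) (mpoly.muni p) != 0.
  by apply: contra vP => /eqP P00; rewrite lead_coefE -coef_map P00 coef0.
by exists (extend_point v y); rewrite meval_muni.
Qed.

(** If p involves the last variable but does not divide q, the constant of
    [prime_bezout_const] would have to vanish at every point where the leading
    coefficient of p does not, because p and q have a common zero above it.
    If p does not involve it, all coefficients of q with respect to that variable vanish where
    p does, and the induction hypothesis applies to each of them. *)
Theorem prime_hypersurface_null (K : closedFieldType) n (p q : {mpoly K[n]}) :
  prime_element p -> zero_set p `<=` zero_set q -> divides p q.
Proof.
elim: n p q => [|n IHn] p q pP pq.
  case: pP => p0 + _; case/negP; rewrite (mpoly_dim0 p) rmorph_unit // unitfE.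
  by apply: contra p0 => /eqP c0; rewrite (mpoly_dim0 p) c0.
have PP : prime_element (mpoly.muni p) := prime_element_iso (@muniK n K) (@multi_of_uniK n K) pP.
move: (PP); set P := mpoly.muni p => -[P0 PU primeP].
suff [c cE] : divides P (mpoly.muni q).
  by exists (multi_of_uni c); rewrite -(muniK q) cE rmorphM /= muniK.
have [sP|sP] := ltnP 1 (size P).
  apply: contrapT => ndPQ.
  have [d d0 [U [V dE]]] := prime_bezout_const PP sP ndPQ.
  (* Keeping the leading coefficient keeps the degree, hence a root in y. *)
  have [v] : exists v, (d * lead_coef P).@[v] != 0.
    by apply: mpoly_nonvanishing; rewrite mulf_neq0 ?lead_coef_eq0.
  rewrite rmorphM mulf_eq0 negb_or => /andP[dv lv].
  have sPv : size (map_poly (mpoly.meval v) P) = size P by exact: size_map_poly_id0.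
  have /closed_rootP[y /rootP Py] : size (map_poly (mpoly.meval v) P) != 1%N.
    by rewrite sPv gtn_eqF.
  have Qy : (map_poly (mpoly.meval v) (mpoly.muni q)).[y] = 0.
    by rewrite -meval_muni; apply: pq; rewrite /zero_set /= meval_muni.
  pose ev := horner_eval y \o map_poly (mpoly.meval v).
  have : ev d%:P = 0 by exact: (rmorph_bezout (h := ev) dE Py Qy).
  by rewrite /ev /= /horner_eval map_polyC hornerC => /eqP; rewrite (negPf dv).
have PE := size1_polyC sP; set c := P`_0 in PE.
have cP : prime_element c.
  split.
  - by apply: contra P0 => /eqP c0; rewrite PE c0.
  - by apply: contra PU => cU; rewrite PE rmorph_unit.
  - move=> a b [d abE].
    have /primeP : divides P (a%:P * b%:P) by exists d%:P; rewrite PE -!polyCM abE.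
    case=> -[s sE]; [left|right]; exists s`_0;
      by move/(congr1 (fun s : {poly _} => s`_0)): sE; rewrite PE coefC coefCM.
have dvdQ i : divides c (mpoly.muni q)`_i.
  apply: IHn => // v cv.
  have : map_poly (mpoly.meval v) (mpoly.muni q) = 0.
    apply: contrapT => /eqP/closed_nonrootP[y /negP]; apply; apply/rootP.
    rewrite -meval_muni; apply: pq; rewrite /zero_set /= meval_muni -/P PE.
    by rewrite map_polyC hornerC.
  by move/(congr1 (fun s : {poly _} => s`_i)); rewrite coef_map coef0.
have [S SE] := choice dvdQ.
exists (\poly_(i < size (mpoly.muni q)) S i); apply/polyP => i.
rewrite PE coefCM coef_poly; case: ltnP => [_|sq]; first exact: SE.
by rewrite nth_default // mulr0.
Qed.

Lemma prime_zero_off (K : closedFieldType) n (s t : {mpoly K[n]}) :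
  prime_element s -> ~ divides s t -> exists2 v, s.@[v] = 0 & t.@[v] != 0.
Proof.
move=> sP nst; apply: contrapT => nv; apply: nst.
apply: prime_hypersurface_null => // v sv; apply: contrapT => /eqP tv.
by apply: nv; exists v.
Qed.

(** * Lie derivatives and their logarithmic poles *)

Section Mpoly.
Variables (K : comNzRingType) (n : nat).

Lemma mpoly_ring_ind (P : {mpoly K[n]} -> Prop) :
  (forall c, P (mpoly.mpolyC n c)) -> (forall i, P (mpoly.mpolyX K (mpoly.mnm1 i))) ->
  (forall p q, P p -> P q -> P (p + q)) -> (forall p q, P p -> P q -> P (p * q)) ->
  forall p, P p.
Proof.
move=> PC PX PD PM; elim/mpoly.mpolyind => [|c m p _ _ Pp].
  by rewrite -mpoly.mpolyC0.
apply: PD => //; rewrite -mpoly.mul_mpolyC mpoly.mpolyXE_id.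
apply: (PM _ _ (PC c)); elim/big_ind: _ => [||i _]; [exact: (PC 1)|exact: PM|].
by elim: (mpoly.fun_of_multinom m i) => [|k IHk];
  rewrite ?expr0 ?exprS; [exact: (PC 1)|exact: PM].
Qed.
End Mpoly.

Section LieDerivative.
Variables (K : fieldType) (n : nat) (f : vfield K n).

Lemma lie_derivativeM p q :
  lie_derivative f (p * q) = lie_derivative f p * q + p * lie_derivative f q.
Proof.
rewrite /lie_derivative mulr_suml mulr_sumr -big_split /=; apply: eq_bigr => i _.
by rewrite mpoly.mderivM; ring.
Qed.

Lemma lie_derivative_is_linear : linear (lie_derivative f).
Proof.
move=> c p q; rewrite /lie_derivative scaler_sumr -big_split /=.
by apply: eq_bigr => i _; rewrite mpoly.mderiv_is_linear mulrDl scalerAl.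
Qed.

HB.instance Definition _ := GRing.isLinear.Build K _ _ _ (lie_derivative f)
  lie_derivative_is_linear.

Lemma lie_derivativeC c : lie_derivative f (mpoly.mpolyC n c) = 0.
Proof.
by rewrite /lie_derivative big1 // => i _; rewrite mpoly.mderivC mul0r.
Qed.

Lemma lie_derivative_var i : lie_derivative f (mpoly.mpolyX K (mpoly.mnm1 i)) = f i 0.
Proof.
rewrite /lie_derivative (bigD1 i) //= big1 ?addr0 => [|k ki].
  rewrite mpoly.mderivX mpoly.mnm1E eqxx scale1r.
  by rewrite (_ : mpoly.mnm_sub _ _ = mpoly.mnm0) ?mpoly.mpolyX0 ?mul1r //;
     apply/mpoly.mnmP => k; rewrite mpoly.mnmBE subnn mpoly.mnm0E.
by rewrite mpoly.mderivX mpoly.mnm1E eq_sym (negPf ki) scale0r mul0r.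
Qed.

Lemma lie_derivative1 : lie_derivative f 1 = 0.
Proof.
by rewrite /lie_derivative big1 // => i _; rewrite -mpoly.mpolyC1 mpoly.mderivC mul0r.
Qed.

Lemma lie_derivativeX p k :
  lie_derivative f (p ^+ k) = k%:R * p ^+ k.-1 * lie_derivative f p.
Proof.
elim: k => [|k IHk]; first by rewrite expr0 lie_derivative1 !mul0r.
rewrite exprS lie_derivativeM IHk -natr1.
by case: k {IHk} => [|k]; rewrite /= ?expr0 ?exprS; ring.
Qed.

End LieDerivative.

(** The two computations with quotients that the next result needs, isolated
    over an arbitrary field: S and T stand for s and t, E for s^(k-1), L for
    X_f(s), and X for X_f(t). *)
Lemma log_derivative_clear (F : fieldType) (E S T B k L X D a : F) :
  E != 0 -> S != 0 -> T != 0 -> B != 0 ->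
  - (E * (k * L * T + S * X) / (S * E * T) - D) = a / B ->
  E * (k * L * T * B + S * X * B) = E * (S * T * (D * B - a)).
Proof.
move=> E0 S0 T0 B0 aE; have -> : a = B * (a / B) by field.
by rewrite -aE; field; rewrite E0 S0 T0.
Qed.

Lemma log_derivative_quotient (F : fieldType) (E S T k c X D : F) :
  E != 0 -> S != 0 -> T != 0 ->
  - (E * (k * (S * c) * T + S * X) / (S * E * T) - D) = (T * D - k * c * T - X) / T.
Proof. by move=> E0 S0 T0; field; rewrite E0 S0 T0. Qed.

(** Clearing denominators in an expression a/b of the left-hand side, with b
    nonzero at v, shows that s divides k X_f(s) t b.  Neither k nor t nor b is
    divisible by s, because s vanishes at v and they do not; characteristic 0
    is what keeps k away from 0.  Conversely, if s divides X_f(s), all powers of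
    s cancel and t is a denominator. *)
Lemma regular_logarithmic_derivative (K : fieldType) n (f : vfield K n)
    (s t d : {mpoly K[n]}) (k : nat) (v : 'I_n -> K) :
  [pchar K] =i pred0 -> (0 < k)%N ->
  prime_element s -> t.@[v] != 0 -> s.@[v] = 0 ->
  regular_at (- (tofrac (lie_derivative f (s ^+ k * t)) / tofrac (s ^+ k * t)
     - tofrac d)) v <-> divides s (lie_derivative f s).
Proof.
case: k => // k K0 _ sP tv sv; have [s0 sU primes] := sP.
have t0 : t != 0 by apply: contra_neq tv => ->; rewrite mpoly.meval0.
have lieE : lie_derivative f (s ^+ k.+1 * t) =
    s ^+ k * (k.+1%:R * lie_derivative f s * t + s * lie_derivative f t).
  rewrite lie_derivativeM lie_derivativeX /= exprS; ring.
have F0 (a : {mpoly K[n]}) : a != 0 -> tofrac a != 0 by rewrite tofrac_eq0.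
split=> [[a [b [bv]]]|[c cE]].
  have b0 : b != 0 by apply: contra_neq bv => ->; rewrite mpoly.meval0.
  move=> abE.
  have : k.+1%:R * lie_derivative f s * t * b + s * lie_derivative f t * b = s * t * (d * b - a).
    have e0 : s ^+ k != 0 by rewrite expf_neq0.
    apply: (mulfI e0); apply/eqP; rewrite -tofrac_eq; apply/eqP.
    move: abE; rewrite lieE exprS.
    rewrite !(rmorphM, rmorphD, rmorphB, rmorphN) /=.
    by apply: log_derivative_clear; rewrite ?F0.
  move=> bE; have : divides s (k.+1%:R * lie_derivative f s * t * b).
    exists (t * (d * b - a) - lie_derivative f t * b).
    by move/(canRL (addrK _)): bE => ->; ring.
  have nv u : u.@[v] != 0 -> ~ divides s u.
    by move=> uv [w uE]; move: uv; rewrite uE mpoly.mevalM sv mul0r eqxx.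
  case/primes=> [/primes[/primes[|]|]|] // /nv[] //.
  rewrite -mpoly.mpolyC_nat mpoly.mevalC.
  by move: K0 => /pcharf0P ->.
exists (t * d - k.+1%:R * c * t - lie_derivative f t), t; split=> //.
have e0 : s ^+ k != 0 by rewrite expf_neq0.
rewrite lieE cE exprS.
rewrite !(rmorphM, rmorphD, rmorphB, rmorphN) /=.
by apply: log_derivative_quotient; rewrite ?F0.
Qed.

(** * Polynomials along a solution *)

Section Curves.
Variable R : realType.
Local Notation Re := complex.Re.
Local Notation Im := complex.Im.

Lemma Re_add (z w : R[i]) : Re (z + w) = Re z + Re w.
Proof. by case: z w => [a b] [c d]. Qed.

Lemma Im_add (z w : R[i]) : Im (z + w) = Im z + Im w.
Proof. by case: z w => [a b] [c d]. Qed.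

Lemma Re_mul (z w : R[i]) : Re (z * w) = Re z * Re w - Im z * Im w.
Proof. by case: z w => [a b] [c d]. Qed.

Lemma Im_mul (z w : R[i]) : Im (z * w) = Re z * Im w + Im z * Re w.
Proof. by case: z w => [a b] [c d]. Qed.

(** The componentwise notion of derivative that [is_solution] imposes on the
    coordinates of a solution. *)
Definition has_complex_derivative (t : R) (z : R -> R[i]) (d : R[i]) :=
  is_derive t (1 : R) (fun s => Re (z s)) (Re d) /\
  is_derive t (1 : R) (fun s => Im (z s)) (Im d).

Lemma has_complex_derivative_cst t c : has_complex_derivative t (fun=> c) 0.
Proof. by split; exact: is_derive_cst. Qed.

Lemma has_complex_derivativeD t z w d e :
  has_complex_derivative t z d -> has_complex_derivative t w e ->
  has_complex_derivative t (fun s => z s + w s) (d + e).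
Proof.
move=> [zR zI] [wR wI]; split.
  rewrite (_ : (fun s => _) = (fun s => Re (z s)) + (fun s => Re (w s))).
    by apply: is_derive_eq; rewrite Re_add.
  by apply/funext => s; rewrite /= Re_add.
rewrite (_ : (fun s => _) = (fun s => Im (z s)) + (fun s => Im (w s))).
  by apply: is_derive_eq; rewrite Im_add.
by apply/funext => s; rewrite /= Im_add.
Qed.

Lemma has_complex_derivativeM t z w d e :
  has_complex_derivative t z d -> has_complex_derivative t w e ->
  has_complex_derivative t (fun s => z s * w s) (d * w t + z t * e).
Proof.
move=> [zR zI] [wR wI]; split.
  rewrite (_ : (fun s => _) = (fun s => Re (z s)) * (fun s => Re (w s))
     - (fun s => Im (z s)) * (fun s => Im (w s))).
    by apply: is_derive_eq; rewrite Re_add !Re_mul /= /GRing.scale /=; ring.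
  by apply/funext => s; rewrite /= Re_mul.
rewrite (_ : (fun s => _) = (fun s => Re (z s)) * (fun s => Im (w s))
   + (fun s => Im (z s)) * (fun s => Re (w s))).
  apply: is_derive_eq; rewrite Im_add !Im_mul /= /GRing.scale /=; ring.
by apply/funext => s; rewrite /= Im_mul.
Qed.

Variables (n : nat) (f : vfield R[i] n).

(** The chain rule.  Both sides are additive and obey the same product rule in
    p, so constants and variables suffice; for a variable this is the
    differential equation. *)
Lemma lie_derivative_along_solution I (x : R -> 'I_n -> R[i]) t (p : {mpoly R[i][n]}) :
  is_solution f I x -> I t ->
  has_complex_derivative t (fun s => p.@[x s]) (lie_derivative f p).@[x t].
Proof.
move=> /(_ t) + It => /(_ It) xf.
elim/mpoly_ring_ind: p => [c|i|p q Pp Pq|p q Pp Pq].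
- rewrite lie_derivativeC mpoly.meval0.
  rewrite (_ : (fun s => _) = fun=> c); first exact: has_complex_derivative_cst.
  by apply/funext => s; rewrite mpoly.mevalC.
- rewrite lie_derivative_var (_ : (fun s => _) = fun s => x s i); first exact: xf.
  by apply/funext => s; rewrite mpoly.mevalXU.
- rewrite linearD mpoly.mevalD.
  rewrite (_ : (fun s => _) = fun s => p.@[x s] + q.@[x s]).
    exact: (has_complex_derivativeD Pp Pq).
  by apply/funext => s; rewrite mpoly.mevalD.
- rewrite lie_derivativeM mpoly.mevalD !mpoly.mevalM.
  rewrite (_ : (fun s => _) = fun s => p.@[x s] * q.@[x s]).
    exact: (has_complex_derivativeM Pp Pq).
  by apply/funext => s; rewrite mpoly.mevalM.
Qed.

(** N(t) exp(-C t) is nonincreasing, which carries the zero forwards, and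
    N(t) exp(C t) is nondecreasing, which carries it backwards. *)
Lemma gronwall_zero (N dN : R -> R) (C a b : R) :
  (forall t, t \in `[a, b] -> is_derive t (1 : R) N (dN t)) ->
  (forall t, t \in `[a, b] -> 0 <= N t) ->
  (forall t, t \in `[a, b] -> `|dN t| <= C * N t) ->
  a <= b -> N a = 0 <-> N b = 0.
Proof.
move=> N' N0 NC ab.
have ain : a \in `[a, b] by rewrite in_itv /= lexx.
have bin : b \in `[a, b] by rewrite in_itv /= lexx andbT.
pose h e t := N t * expR (e * t).
have h' e t : t \in `[a, b] -> is_derive t (1 : R) (h e) ((dN t + e * N t) * expR (e * t)).
  move=> /N' Nt; rewrite /h.
  have E' : is_derive t (1 : R) (fun s : R => expR (e * s)) (e * expR (e * t)).
    have e' : is_derive t (1 : R) (fun s : R => e * s) e.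
      rewrite (_ : (fun s : R => _) = e \*: id); last by apply/funext.
      by apply: is_derive_eq; rewrite /GRing.scale /= mulr1.
    by rewrite mulrC; exact: (is_derive1_comp (is_derive_expR _) e').
  rewrite (_ : (fun s : R => _) = N * (fun s : R => expR (e * s))); last by apply/funext.
  by apply: is_derive_eq; rewrite /GRing.scale /=; ring.
have hd e t : t \in `]a, b[ -> derive1 (h e) t = (dN t + e * N t) * expR (e * t).
  by move=> /subset_itv_oo_cc/(h' e) ht; rewrite derive1E derive_val.
have hder e t : t \in `]a, b[ -> derivable (h e) t 1.
  by move=> /subset_itv_oo_cc/(h' e) [].
have hcont e : {within `[a, b], continuous (h e)}.
  by apply: derivable_within_continuous => t /(h' e) [].
have NCle t : t \in `[a, b] -> dN t <= C * N t.
  by move=> /NC; apply: le_trans; exact: ler_norm.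
have NCge t : t \in `[a, b] -> - (C * N t) <= dN t.
  by move=> /NC; rewrite lerNl; apply: le_trans; rewrite -normrN; exact: ler_norm.
split=> [Na|Nb].
  have : h (- C) b <= h (- C) a.
    apply: (@ler0_derive1_nincr _ _ a b) => // t tab; rewrite ?hd //; first exact: hder.
    rewrite pmulr_lle0 ?expR_gt0 // mulNr subr_le0.
    by apply: NCle; exact: subset_itv_oo_cc.
  rewrite /h Na mul0r pmulr_lle0 ?expR_gt0 // => Nb.
  by apply/eqP; rewrite eq_le Nb N0.
have : h C a <= h C b.
  apply: (@ger0_derive1_ndecr _ _ a b) => // t tab; rewrite ?hd //; first exact: hder.
  rewrite pmulr_lge0 ?expR_gt0 // -lerBlDr sub0r.
  by apply: NCge; exact: subset_itv_oo_cc.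
rewrite /h Nb mul0r pmulr_lle0 ?expR_gt0 // => Na.
by apply/eqP; rewrite eq_le Na N0.
Qed.

(** With X_f(s) = s c, the squared modulus N of s along a solution satisfies
    N' = 2 Re(c) N, and Re(c) is bounded on compact time intervals. *)
Lemma divides_invariant (s : {mpoly R[i][n]}) :
  divides s (lie_derivative f s) -> invariant_set f (zero_set s).
Proof.
move=> [c cE] I x _ Iitv I0 xf; rewrite /zero_set /= => sx0 t It.
pose y u := s.@[x u].
pose N u := Re (y u) ^+ 2 + Im (y u) ^+ 2.
pose r u := Re c.@[x u].
have y' u : I u -> has_complex_derivative u y (y u * c.@[x u]).
  by move=> /(lie_derivative_along_solution s xf); rewrite cE mpoly.mevalM.
have N' u : I u -> is_derive u (1 : R) N (2 * r u * N u).
  move=> /y'[yR yI].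
  have := is_deriveD (is_deriveM yR yR) (is_deriveM yI yI).
  rewrite (_ : _ + _ = N); last by apply/funext => w; rewrite /N !expr2.
  by move=> /is_derive_eq; apply; rewrite /N /r Re_mul Im_mul /GRing.scale /=; ring.
have r2' u : I u -> derivable (fun u => r u ^+ 2) u 1.
  move=> /(lie_derivative_along_solution c xf)[rR _].
  have := is_deriveM rR rR.
  rewrite (_ : _ * _ = fun u => r u ^+ 2); last by apply/funext => w; rewrite expr2.
  by case.
have N0 u : 0 <= N u by rewrite addr_ge0 // sqr_ge0.
have key a b : I a -> I b -> a <= b -> N a = 0 <-> N b = 0.
  move=> Ia Ib ab.
  have abI u : u \in `[a, b] -> I u by rewrite in_itv /= => /Iitv; apply.
  have [M _ rM] : exists2 M, M \in `[a, b] & forall u, u \in `[a, b] -> r u ^+ 2 <= r M ^+ 2.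
    apply: EVT_max => //; apply: derivable_within_continuous => u /abI; exact: r2'.
  (* The bound comes from |2 r| <= 1 + r^2, the square being differentiable. *)
  apply: (@gronwall_zero N (fun u => 2 * r u * N u) (1 + r M ^+ 2)) => // u uab.
    by apply: N'; exact: abI.
  rewrite normrM (ger0_norm (N0 u)) ler_wpM2r //.
  have := rM _ uab; have := sqr_ge0 (r u - 1); have := sqr_ge0 (r u + 1).
  rewrite ler_norml; nra.
have Nx0 : N 0 = 0 by rewrite /N /y sx0 /= expr0n addr0.
have : N t = 0.
  by have [t0|t0] := leP 0 t; [apply/(key 0 t)|apply/(key t 0) => //; exact: ltW].
rewrite /N /y; case: s.@[x t] => p q /= /eqP.
by rewrite paddr_eq0 ?sqr_ge0 // !sqrf_eq0 => /andP[/eqP-> /eqP->].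
Qed.
End Curves.

(** * Growth of iterated Lie derivatives *)

(** Each factor is at most e (d + j + 1), and the product of the d + j + 1 is
    k! times a binomial coefficient of d + k.  The point is that d enters only
    through the geometric factor 2^d, which leaves the rate in k independent
    of d. *)
Lemma prod_arith_le d e k : (0 < e)%N ->
  (\prod_(j < k) (d + j * e) <= 2 ^ (d + k) * e ^ k * k`!)%N.
Proof.
move=> e0; have -> : (e ^ k = \prod_(j < k) e)%N by rewrite prod_nat_const card_ord.
have rise : (d`! * \prod_(j < k) (d + j.+1) = (d + k)`!)%N.
  elim: k => [|k IHk]; first by rewrite big_ord0 muln1 addn0.
  by rewrite big_ord_recr /= mulnA IHk addnS factS mulnC.
have binle : ('C(d + k, k) <= 2 ^ (d + k))%N.
  rewrite -[2%N]/(1 + 1)%N expnDn.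
  rewrite (bigD1 (Ordinal (_ : k < (d + k).+1)%N)) /= ?ltnS ?leq_addl // => ?.
  by rewrite !exp1n !muln1 leq_addr.
have riseE : (\prod_(j < k) (d + j.+1) = 'C(d + k, k) * k`!)%N.
  apply/eqP; rewrite -(eqn_pmul2l (fact_gt0 d)) rise.
  by rewrite -(@bin_fact (d + k) k) ?leq_addl // addnK; apply/eqP; lia.
apply: (@leq_trans ((\prod_(j < k) e) * \prod_(j < k) (d + j.+1)))%N.
  rewrite -big_split /=; apply: leq_prod => j _; nia.
by rewrite riseE mulnA leq_mul2r mulnC leq_mul2r binle !orbT.
Qed.

Section LieBound.
Variables (K : numFieldType) (n : nat) (f : vfield K n) (v : 'I_n -> K).
Local Notation D := (lie_derivative f).

Fact iter_lie_derivative_is_linear k : linear (iter k D).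
Proof. by elim: k => [|k IHk] c p q //=; rewrite IHk linearP. Qed.
HB.instance Definition _ k := GRing.isLinear.Build K _ _ _ (iter k D)
  (iter_lie_derivative_is_linear k).

Section Monomials.
Variables (F s : K) (e : nat).
Hypothesis FE : F = \sum_(i < n) \sum_(m <- mpoly.msupp (f i 0)) `|mpoly.mcoeff m (f i 0)|.
Hypothesis s_ge1 : 1 <= s.
Hypothesis v_le : forall i, `|v i| <= s.
Hypothesis mdeg_le : forall i m, m \in mpoly.msupp (f i 0) -> (mpoly.mdeg m <= e)%N.

Let s_ge0 : 0 <= s. Proof. exact: le_trans s_ge1. Qed.

Let F_ge0 : 0 <= F.
Proof. by rewrite FE; apply: sumr_ge0 => i _; apply: sumr_ge0. Qed.

Lemma meval_monomial_le m : `|(mpoly.mpolyX K m).@[v]| <= s ^+ mpoly.mdeg m.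
Proof.
rewrite mpoly.mevalX mpoly.mdegE expr_sum normr_prod.
apply: ler_prod => i _; rewrite normr_ge0 normrX /=.
by apply: lerXn2r; rewrite ?nnegrE ?v_le.
Qed.

(** Deriving a monomial of degree at most d along f gives monomials of degree
    at most d + e whose coefficients have total modulus at most d F; iterating
    k times multiplies the factors d, d + e, ..., d + (k-1) e. *)
Lemma iter_monomial_le k d m : (mpoly.mdeg m <= d)%N ->
  `|(iter k D (mpoly.mpolyX K m)).@[v]| <=
    s ^+ (d + k * e) * (\prod_(j < k) (d + j * e))%N%:R * F ^+ k.
Proof.
elim: k d m => [|k IHk] d m md.
  rewrite big_ord0 !mulr1 addn0 /=; apply: le_trans (meval_monomial_le m) _.
  exact: ler_weXn2l.
have DX : D (mpoly.mpolyX K m) = \sum_(i < n) \sum_(m' <- mpoly.msupp (f i 0))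
    ((mpoly.fun_of_multinom m i)%:R * mpoly.mcoeff m' (f i 0)) *:
      mpoly.mpolyX K (mpoly.mnm_add (mpoly.mnm_sub m (mpoly.mnm1 i)) m').
  apply: eq_bigr => i _; rewrite mpoly.mderivX [X in _ * X]mpoly.mpolyE mulr_sumr.
  by apply: eq_bigr => m' _; rewrite mpoly.mpolyXD -scalerAl -scalerAr scalerA.
pose b := s ^+ (d + k.+1 * e) * (\prod_(j < k) (d + e + j * e))%N%:R * F ^+ k.
have b0 : 0 <= b by rewrite !mulr_ge0 ?exprn_ge0 ?ler0n.
have -> : s ^+ (d + k.+1 * e) * (\prod_(j < k.+1) (d + j * e))%N%:R * F ^+ k.+1 = d%:R * F * b.
  rewrite big_ord_recl mul0n addn0 natrM exprS /b.
  rewrite (eq_bigr (fun j : 'I_k => (d + e + j * e)%N)); first by ring.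
  by move=> j _; rewrite /= mulSn addnA.
have termE i m' : m' \in mpoly.msupp (f i 0) ->
    `|(iter k D (((mpoly.fun_of_multinom m i)%:R * mpoly.mcoeff m' (f i 0)) *:
      mpoly.mpolyX K (mpoly.mnm_add (mpoly.mnm_sub m (mpoly.mnm1 i)) m'))).@[v]|
    <= d%:R * `|mpoly.mcoeff m' (f i 0)| * b.
  move=> m'f; rewrite linearZ mpoly.mevalZ !normrM normr_nat.
  apply: ler_pM => //.
    apply: ler_wpM2r => //; rewrite ler_nat; apply: leq_trans md.
    by rewrite mpoly.mdegE (bigD1 i) //= leq_addr.
  have := IHk (d + e)%N (mpoly.mnm_add (mpoly.mnm_sub m (mpoly.mnm1 i)) m').
  rewrite /b mulSn addnA; apply; rewrite mpoly.mdegD leq_add //.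
    exact: leq_trans (mpoly.mdegB _ _) md.
  exact: mdeg_le m'f.
rewrite iterSr DX linear_sum rmorph_sum /=.
apply: le_trans (ler_norm_sum _ _ _) _.
rewrite FE mulr_sumr mulr_suml; apply: ler_sum => i _.
rewrite linear_sum rmorph_sum /=.
apply: le_trans (ler_norm_sum _ _ _) _.
rewrite mulr_sumr mulr_suml big_seq [leRHS]big_seq; apply: ler_sum => m' m'f.
exact: termE.
Qed.

End Monomials.

(** A Cauchy-type estimate obtained without analysis.  The constant M does not
    depend on p, so that the Lie series of all polynomials share a disc of
    convergence. *)
Lemma iter_lie_derivative_bound :
  exists2 M : K, 0 <= M & forall p, exists2 B : K, 0 <= B &
    forall k, `|(iter k D p).@[v]| <= B * M ^+ k * k`!%:R.
Proof.
pose F := \sum_(i < n) \sum_(m <- mpoly.msupp (f i 0)) `|mpoly.mcoeff m (f i 0)|.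
have [s [s_ge1 v_le]] : exists s : K, 1 <= s /\ forall i, `|v i| <= s.
  exists (1 + \sum_(i < n) `|v i|); split; first by rewrite lerDl sumr_ge0.
  by move=> i; rewrite (bigD1 i) //= addrCA lerDl addr_ge0 // sumr_ge0.
have [e [e_gt0 mdeg_le]] : exists e, (0 < e)%N /\
    forall i m, m \in mpoly.msupp (f i 0) -> (mpoly.mdeg m <= e)%N.
  (* The successor makes e positive even for a constant field. *)
  exists (\max_(i < n) \max_(m <- mpoly.msupp (f i 0%R)) mpoly.mdeg m).+1; split=> // i m mf.
  apply: leq_trans (leqnSn _); apply: leq_trans (leq_bigmax i).
  exact: leq_bigmax_seq.
have s_ge0 : 0 <= s by exact: le_trans s_ge1.
have F_ge0 : 0 <= F by apply: sumr_ge0 => i _; apply: sumr_ge0.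
exists (2 * e%:R * F * s ^+ e) => [|p]; first by rewrite !mulr_ge0 ?exprn_ge0.
exists (\sum_(m <- mpoly.msupp p) `|mpoly.mcoeff m p| * (2 * s) ^+ mpoly.mdeg m).
  by apply: sumr_ge0 => m _; rewrite mulr_ge0 ?exprn_ge0 ?mulr_ge0.
move=> k; rewrite [X in iter k D X]mpoly.mpolyE linear_sum rmorph_sum /=.
apply: le_trans (ler_norm_sum _ _ _) _.
rewrite !mulr_suml; apply: ler_sum => m _.
rewrite linearZ mpoly.mevalZ normrM -!mulrA; apply: ler_wpM2l => //.
apply: le_trans (iter_monomial_le (erefl F) s_ge1 v_le mdeg_le _ (leqnn _)) _.
set d := mpoly.mdeg m.
have : (\prod_(j < k) (d + j * e))%N%:R <= (2 ^ (d + k) * e ^ k * k`!)%N%:R :> K.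
  by rewrite ler_nat prod_arith_le.
rewrite !natrM !natrX => /(ler_wpM2l (exprn_ge0 (d + k * e) s_ge0)).
move=> /(ler_wpM2r (exprn_ge0 k F_ge0)) /le_trans; apply.
rewrite le_eqVlt; apply/orP; left; apply/eqP.
rewrite !exprMn !exprD [(k * e)%N]mulnC !exprM; ring.
Qed.

End LieBound.

(** * Power series with geometrically bounded coefficients *)

Section PowerSeries.
Variables (R : realType) (M : R).
Hypothesis M_gt0 : 0 < M.
Implicit Types (a b : R^nat) (t : R).

Definition geometrically_bounded a := exists B, forall k, `|a k| <= B * M ^+ k.

Definition convolution a b k := \sum_(i < k.+1) a i * b (k - i)%N.

(** Summation over the triangle i + j < N, by rows instead of diagonals. *)
Lemma sum_convolution a b N :
  \sum_(k < N) convolution a b k = \sum_(i < N) a i * \sum_(j < N - i) b j.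
Proof.
elim: N => [|N IHN]; first by rewrite !big_ord0.
rewrite big_ord_recr /= IHN /convolution !big_ord_recr /= subSnn subnn big_ord1.
rewrite addrA -big_split /=; congr (_ + _); apply: eq_bigr => i _.
by rewrite subSn 1?ltnW // big_ord_recr /= mulrDr.
Qed.

Lemma pseries_cvg a t : geometrically_bounded a -> M * `|t| < 1 -> cvgn (pseries a t).
Proof.
move=> [B aB] Mt; apply: normed_cvg.
have B0 : 0 <= B by have := aB 0; rewrite expr0 mulr1; apply: le_trans.
apply: (@series_le_cvg _ _ (geometric B (M * `|t|))) => [k|k|k|]; first exact: normr_ge0.
- by rewrite /geometric /= mulr_ge0 // exprn_ge0 // mulr_ge0 // ltW.
- by rewrite /geometric /= normrM normrX exprMn mulrA ler_wpM2r // exprn_ge0.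
- by apply: is_cvg_geometric_series; rewrite ger0_norm // mulr_ge0 // ltW.
Qed.

(** The product of the partial sums exceeds the partial sum of the Cauchy
    product by the terms u_i w_j with i, j < N <= i + j.  With rho = M |t| there
    are at most N^2 of them, each at most A B rho^N.  The factor 4 in the
    hypothesis makes N^2 <= 4^N enough to send this to 0. *)
Lemma pseries_convolution a b t :
  geometrically_bounded a -> geometrically_bounded b -> 4 * (M * `|t|) < 1 ->
  pseries (convolution a b) t @ \oo --> limn (pseries a t) * limn (pseries b t).
Proof.
move=> aM bM t4.
have M0 := ltW M_gt0.
have Mt0 : 0 <= M * `|t| by rewrite mulr_ge0.
have Mt : M * `|t| < 1 by lra.
have ca := pseries_cvg aM Mt; have cb := pseries_cvg bM Mt.
move: aM bM => [A aA] [B bB].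
have A0 : 0 <= A by have := aA 0; rewrite expr0 mulr1; apply: le_trans.
have B0 : 0 <= B by have := bB 0; rewrite expr0 mulr1; apply: le_trans.
pose d N := pseries a t N * pseries b t N - pseries (convolution a b) t N.
suff d0 : d @ \oo --> 0.
  rewrite (_ : pseries _ t = (fun N => pseries a t N * pseries b t N - d N)).
    by rewrite -[X in _ --> X]subr0; exact: (cvgB (cvgM ca cb) d0).
  by apply/funext => N; rewrite /d; ring.
have dle N : `|d N| <= geometric (A * B) (4 * (M * `|t|)) N.
  pose u k := a k * t ^+ k; pose w k := b k * t ^+ k.
  have uA k : `|u k| <= A * (M * `|t|) ^+ k.
    by rewrite normrM normrX exprMn mulrA ler_wpM2r // exprn_ge0.
  have wB k : `|w k| <= B * (M * `|t|) ^+ k.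
    by rewrite normrM normrX exprMn mulrA ler_wpM2r // exprn_ge0.
  have convE k : convolution a b k * t ^+ k = convolution u w k.
    rewrite /convolution mulr_suml; apply: eq_bigr => i _.
    have -> : t ^+ k = t ^+ (k - i) * t ^+ i by rewrite -exprD subnK // -ltnS.
    by rewrite /u /w; ring.
  have -> : d N = \sum_(i < N) u i * \sum_((N - i)%N <= j < N) w j.
    rewrite /d /pseries /series /= !big_mkord.
    rewrite [X in _ - X](eq_bigr (fun k : 'I_N => convolution u w k)); last by move=> k _.
    rewrite sum_convolution mulr_suml -sumrB; apply: eq_bigr => i _.
    rewrite -mulrBr -!(big_mkord xpredT w); congr (_ * _).
    by rewrite (@big_cat_nat _ _ _ (N - i)%N) ?leq_subr //= addrAC subrr add0r.
  apply: le_trans (ler_norm_sum _ _ _) _.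
  apply: (@le_trans _ _ (\sum_(i < N) N%:R * (A * B * (M * `|t|) ^+ N))).
    apply: ler_sum => i _; rewrite normrM.
    have wle : `|\sum_((N - i)%N <= j < N) w j| <= N%:R * (B * (M * `|t|) ^+ (N - i)).
      apply: le_trans (ler_norm_sum _ _ _) _.
      apply: (@le_trans _ _ (\sum_((N - i)%N <= j < N) B * (M * `|t|) ^+ (N - i))).
        apply: ler_sum_nat => j /andP[Nij _]; apply: le_trans (wB j) _.
        by rewrite ler_wpM2l // ler_wiXn2l // ltW.
      rewrite sumr_const_nat subKn; last exact: ltnW.
      rewrite -[leLHS]mulr_natl.
      apply: ler_wpM2r; first by rewrite mulr_ge0 // exprn_ge0.
      by rewrite ler_nat ltnW.
    apply: le_trans (ler_pM _ _ (uA i) wle) _ => //.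
    have -> : (M * `|t|) ^+ N = (M * `|t|) ^+ i * (M * `|t|) ^+ (N - i).
      by rewrite -exprD subnKC // ltnW.
    by rewrite le_eqVlt; apply/orP; left; apply/eqP; ring.
  rewrite sumr_const card_ord -[leLHS]mulr_natl /geometric /= [(4 * _) ^+ N]exprMn.
  rewrite mulrA [leRHS]mulrCA ler_wpM2r //; first by rewrite !mulr_ge0 ?exprn_ge0.
  rewrite -natrM -natrX ler_nat -[4%N]/(2 * 2)%N expnMn.
  by rewrite leq_mul // ltnW // ltn_expl.
have g0 : geometric (A * B) (4 * (M * `|t|)) @ \oo --> 0.
  by apply: cvg_geometric; rewrite ger0_norm // mulr_ge0.
apply/norm_cvg0P.
apply: (squeeze_cvgr _ (cvg_cst 0) g0).
by near=> N; rewrite normr_ge0 dle.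
Unshelve. all: by end_near. Qed.

(** Termwise differentiation, compared with the convergence of the three series
    at a point K halfway between |t| and 1/M. *)
Lemma pseries_is_derive a t :
  geometrically_bounded a -> geometrically_bounded (pseries_diffs a) ->
  geometrically_bounded (pseries_diffs (pseries_diffs a)) -> M * `|t| < 1 ->
  is_derive t (1 : R) (fun s => limn (pseries a s)) (limn (pseries (pseries_diffs a) t)).
Proof.
move=> a0 a1 a2 Mt.
pose K := (`|t| + M^-1) / 2.
have tM : `|t| < M^-1 by rewrite -[M^-1]mul1r ltr_pdivlMr // mulrC.
have K0 : 0 <= K by rewrite /K; have := normr_ge0 t; lra.
have MK : M * `|K| < 1.
  rewrite ger0_norm // mulrC -ltr_pdivlMr // mul1r /K; lra.
apply: (@pseries_snd_diffs _ _ K); try exact: pseries_cvg.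
by rewrite (ger0_norm K0) /K; lra.
Qed.

(** Computes both the series of a constant polynomial and the value at time 0. *)
Lemma limn_pseries_head a t : (forall k, a k.+1 * t ^+ k.+1 = 0) -> limn (pseries a t) = a 0.
Proof.
move=> a0; apply: cvg_lim => //; rewrite -cvg_shiftS.
apply: cvg_near_cst; near=> N.
by rewrite /pseries /series /= big_nat_recl //= expr0 mulr1 big1 ?addr0.
Unshelve. all: by end_near. Qed.

Lemma pseriesD a b t :
  pseries (fun k => a k + b k) t = (fun N => pseries a t N + pseries b t N).
Proof.
apply/funext => N; rewrite /pseries /series /= -big_split /=.
by apply: eq_bigr => k _; rewrite mulrDl.
Qed.

Lemma pseriesN a t : pseries (fun k => - a k) t = (fun N => - pseries a t N).
Proof.
apply/funext => N; rewrite /pseries /series /= -sumrN.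
by apply: eq_bigr => k _; rewrite mulNr.
Qed.
End PowerSeries.

(** * Local solutions by Lie series *)

Section LieSeries.
Variables (R : realType) (n : nat) (f : vfield R[i] n) (v : 'I_n -> R[i]).
Local Notation D := (lie_derivative f).
Local Notation Re := complex.Re.
Local Notation Im := complex.Im.

Let Re_sum (I : Type) (l : seq I) (F : I -> R[i]) : Re (\sum_(i <- l) F i) = \sum_(i <- l) Re (F i).
Proof. exact: (big_morph (@complex.Re R) (@Re_add R) (erefl (@complex.Re R 0))). Qed.

Let Im_sum (I : Type) (l : seq I) (F : I -> R[i]) : Im (\sum_(i <- l) F i) = \sum_(i <- l) Im (F i).
Proof. exact: (big_morph (@complex.Im R) (@Im_add R) (erefl (@complex.Im R 0))). Qed.

(** Taylor coefficients at time 0 of p along the solution starting at v. *)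
Definition lie_coef (p : {mpoly R[i][n]}) (k : nat) : R[i] := (iter k D p).@[v] / k`!%:R.

Lemma lie_coefS p k : k.+1%:R * lie_coef p k.+1 = lie_coef (D p) k.
Proof.
rewrite /lie_coef -iterSr factS natrM; set F := k`!%:R; set E := _.@[v].
have F0 : F != 0 by rewrite pnatr_eq0 -lt0n fact_gt0.
have k0 : k.+1%:R != 0 :> R[i] by rewrite pnatr_eq0.
by field; rewrite F0 addrC natr1 k0.
Qed.

Lemma lie_coefD p q k : lie_coef (p + q) k = lie_coef p k + lie_coef q k.
Proof. by rewrite /lie_coef linearD mpoly.mevalD mulrDl. Qed.

(** The Leibniz rule for iterated derivations, in the normalization that turns
    the binomial sum into a Cauchy product.  In the inductive step the factor
    k + 1 is split as i + (k + 1 - i). *)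
Lemma lie_coefM p q k :
  lie_coef (p * q) k = \sum_(i < k.+1) lie_coef p i * lie_coef q (k - i)%N.
Proof.
elim: k p q => [|k IHk] p q.
  by rewrite big_ord1 /lie_coef /= !divr1 mpoly.mevalM.
have k0 : k.+1%:R != 0 :> R[i] by rewrite pnatr_eq0.
apply: (mulfI k0); rewrite lie_coefS lie_derivativeM lie_coefD !IHk.
have -> : k.+1%:R * (\sum_(i < k.+2) lie_coef p i * lie_coef q (k.+1 - i)%N) =
    \sum_(i < k.+2) (i%:R * lie_coef p i) * lie_coef q (k.+1 - i)%N
    + \sum_(i < k.+2) lie_coef p i * ((k.+1 - i)%N%:R * lie_coef q (k.+1 - i)%N).
  rewrite mulr_sumr -big_split /=; apply: eq_bigr => i _.
  have -> : k.+1%:R = i%:R + (k.+1 - i)%N%:R :> R[i] by rewrite -natrD subnKC // -ltnS.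
  by ring.
rewrite [X in _ = X + _]big_ord_recl mul0r mul0r add0r.
rewrite [in X in _ = _ + X]big_ord_recr /= subnn mul0r mulr0 addr0.
congr (_ + _); apply: eq_bigr => i _; first by rewrite -lie_coefS.
by rewrite subSn 1?lie_coefS // -ltnS.
Qed.

Lemma lie_coef_cst c k : lie_coef (mpoly.mpolyC n c) k = if k is 0 then c else 0.
Proof.
rewrite /lie_coef; case: k => [|k]; first by rewrite mpoly.mevalC divr1.
by rewrite iterSr lie_derivativeC linear0 mpoly.meval0 mul0r.
Qed.

(** Transfers the bound on iterated Lie derivatives to real coefficients; the
    1 added to the rate only makes it positive. *)
Lemma lie_coef_bounded : exists2 M : R, 0 < M & forall p,
  geometrically_bounded M (fun k => Re (lie_coef p k)) /\
  geometrically_bounded M (fun k => Im (lie_coef p k)).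
Proof.
have [M M0 MB] := iter_lie_derivative_bound f v.
have Re_ge0 (z : R[i]) : 0 <= z -> 0 <= Re z by case: z => a b; rewrite lecE => /andP[].
have ReK (z : R[i]) : 0 <= z -> z = (Re z)%:C%C.
  by move=> /ger0_real zR; rewrite RRe_real.
exists (Re M + 1) => [|p]; first by rewrite ltr_wpDl // Re_ge0.
have [B B0 pB] := MB p.
have cB k : `|lie_coef p k| <= (Re B * (Re M + 1) ^+ k)%:C%C.
  apply: (@le_trans _ _ (B * M ^+ k)).
    by rewrite normrM normfV normr_nat ler_pdivrMr ?pB // ltr0n fact_gt0.
  rewrite (ReK _ B0) [M in M ^+ k](ReK _ M0) -rmorphXn -rmorphM lecR /=.
  by rewrite ler_wpM2l ?Re_ge0 // lerXn2r ?nnegrE ?addr_ge0 ?Re_ge0 // lerDl.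
split; exists (Re B) => k; rewrite -lecR; apply: le_trans (cB k).
  exact: normc_ge_Re.
(* The imaginary part is, up to sign, the real part after multiplying by i. *)
have := normc_ge_Re (lie_coef p k * 'i%C).
by rewrite ReiNIm normrN normrM [X in _ * X]normc_def /= expr0n expr1n add0r sqrtr1 mulr1.
Qed.

(** The operator exp(t X_f) applied to p and evaluated at v.  It is assembled
    from two real series because time is real. *)
Definition lie_series (t : R) (p : {mpoly R[i][n]}) : R[i] :=
  (limn (pseries (fun k => Re (lie_coef p k)) t)
    +i* limn (pseries (fun k => Im (lie_coef p k)) t))%C.

Variable M : R.
Hypothesis M_gt0 : 0 < M.
Hypothesis coef_bounded : forall p,
  geometrically_bounded M (fun k => Re (lie_coef p k)) /\
  geometrically_bounded M (fun k => Im (lie_coef p k)).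

Let pseries_diffs_Re p :
  pseries_diffs (fun k => Re (lie_coef p k)) = fun k => Re (lie_coef (D p) k).
Proof.
apply/funext => k; rewrite /pseries_diffs -lie_coefS.
have -> : k.+1%:R = k.+1%:R%:C%C :> R[i] by rewrite rmorph_nat.
by rewrite [RHS]Re_mul /= mul0r subr0.
Qed.

Let pseries_diffs_Im p :
  pseries_diffs (fun k => Im (lie_coef p k)) = fun k => Im (lie_coef (D p) k).
Proof.
apply/funext => k; rewrite /pseries_diffs -lie_coefS.
have -> : k.+1%:R = k.+1%:R%:C%C :> R[i] by rewrite rmorph_nat.
by rewrite [RHS]Im_mul /= mul0r addr0.
Qed.

(** By [lie_coefS], differentiating the series termwise yields the coefficients
    of D p. *)
Lemma lie_series_has_derivative t p : M * `|t| < 1 ->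
  has_complex_derivative t (fun s => lie_series s p) (lie_series t (D p)).
Proof.
move=> Mt; have [r0 i0] := coef_bounded p; have [r1 i1] := coef_bounded (D p).
have [r2 i2] := coef_bounded (D (D p)).
split; rewrite /lie_series /=.
  rewrite -pseries_diffs_Re; apply: (pseries_is_derive M_gt0); rewrite ?pseries_diffs_Re //.
by rewrite -pseries_diffs_Im; apply: (pseries_is_derive M_gt0); rewrite ?pseries_diffs_Im.
Qed.

(** exp(t X_f) is a ring morphism, hence equals evaluation at the images of the
    variables. *)
Lemma lie_series_eval t p : 4 * (M * `|t|) < 1 ->
  lie_series t p = p.@[fun i => lie_series t (mpoly.mpolyX _ (mpoly.mnm1 i))].
Proof.
move=> t4; have Mt : M * `|t| < 1 by have := mulr_ge0 (ltW M_gt0) (normr_ge0 t); lra.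
have cR p := pseries_cvg M_gt0 (coef_bounded p).1 Mt.
have cI p := pseries_cvg M_gt0 (coef_bounded p).2 Mt.
elim/mpoly_ring_ind: p => [c|i|p q Pp Pq|p q Pp Pq].
- rewrite mpoly.mevalC /lie_series !limn_pseries_head => [|k|k].
  + by rewrite !lie_coef_cst; case: c.
  + by rewrite lie_coef_cst mul0r.
  + by rewrite lie_coef_cst mul0r.
- by rewrite mpoly.mevalXU.
- rewrite mpoly.mevalD -Pp -Pq /lie_series; apply/eqP; rewrite eq_complex /=.
  apply/andP; split; apply/eqP; apply: cvg_lim => //.
    rewrite (_ : (fun k => _) = fun k => Re (lie_coef p k) + Re (lie_coef q k)).
      by rewrite pseriesD; exact: cvgD (cR p) (cR q).
    by apply/funext => k; rewrite lie_coefD Re_add.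
  rewrite (_ : (fun k => _) = fun k => Im (lie_coef p k) + Im (lie_coef q k)).
    by rewrite pseriesD; exact: cvgD (cI p) (cI q).
  by apply/funext => k; rewrite lie_coefD Im_add.
rewrite mpoly.mevalM -Pp -Pq /lie_series; apply/eqP; rewrite eq_complex /=.
have [[pR pI] [qR qI]] := (coef_bounded p, coef_bounded q).
apply/andP; split; apply/eqP; apply: cvg_lim => //.
  rewrite (_ : (fun k => _) = fun k =>
      convolution (fun k => Re (lie_coef p k)) (fun k => Re (lie_coef q k)) k
      + - convolution (fun k => Im (lie_coef p k)) (fun k => Im (lie_coef q k)) k).
    rewrite pseriesD pseriesN; apply: cvgB; exact: (pseries_convolution M_gt0).
  apply/funext => k; rewrite lie_coefM /convolution -sumrB Re_sum.
  by apply: eq_bigr => i _; rewrite Re_mul.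
rewrite (_ : (fun k => _) = fun k =>
    convolution (fun k => Re (lie_coef p k)) (fun k => Im (lie_coef q k)) k
    + convolution (fun k => Im (lie_coef p k)) (fun k => Re (lie_coef q k)) k).
  rewrite pseriesD; apply: cvgD; exact: (pseries_convolution M_gt0).
apply/funext => k; rewrite lie_coefM /convolution -big_split /= Im_sum.
by apply: eq_bigr => i _; rewrite Im_mul.
Qed.

Lemma lie_series0 p : lie_series 0 p = p.@[v].
Proof.
rewrite /lie_series !limn_pseries_head => [|k|k]; rewrite ?expr0n ?mulr0 //.
by rewrite /lie_coef /= divr1; case: _.@[v].
Qed.
End LieSeries.

Lemma local_solution (R : realType) n (f : vfield R[i] n) (v : 'I_n -> R[i]) :
  exists2 r : R, 0 < r & exists2 x : R -> 'I_n -> R[i],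
    x 0 = v & is_solution f `]-r, r[ x.
Proof.
have [M M0 bd] := lie_coef_bounded f v.
have r0 : 0 < (4 * M)^-1 by rewrite invr_gt0 mulr_gt0.
exists (4 * M)^-1 => //.
exists (fun t i => lie_series f v t (mpoly.mpolyX _ (mpoly.mnm1 i))).
  by apply/funext => i; rewrite lie_series0 mpoly.mevalXU.
move=> t; rewrite /= in_itv /= -ltr_norml => tr i.
have t4 : 4 * (M * `|t|) < 1 by rewrite mulrA mulrC -ltr_pdivlMr ?mul1r // mulr_gt0.
rewrite -lie_derivative_var -(lie_series_eval M0 bd) // lie_derivative_var.
rewrite -(lie_derivative_var f).
apply: (lie_series_has_derivative M0 bd).
by have := mulr_ge0 (ltW M0) (normr_ge0 t); lra.
Qed.

(** The derivative of s along the solution through v is the value of X_f(s) at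
    v, and invariance keeps s at 0 along that solution. *)
Lemma invariant_lie_derivative0 (R : realType) n (f : vfield R[i] n) (s : {mpoly R[i][n]}) :
  invariant_set f (zero_set s) -> zero_set s `<=` zero_set (lie_derivative f s).
Proof.
move=> sinv v sv.
have [r r0 [x x0 xf]] := local_solution f v.
have I0 : `]-r, r[%classic 0 by rewrite /= in_itv /= oppr_lt0 r0.
have sx t : `]-r, r[%classic t -> s.@[x t] = 0.
  apply: (sinv _ _ _ _ I0 xf); rewrite ?x0 //.
  exact: interval_is_interval.
have zero_deriv (g : R -> R) (d : R) :
    (forall t, t \in `]-r, r[ -> derivable g t 1 /\ g t = 0) ->
    is_derive (0 : R) (1 : R) g d -> d = 0.
  move=> g0 [_ <-].
  have [] : is_derive (0 : R) (1 : R) g 0; last by [].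
  (* A function that is 0 near 0 has a maximum there. *)
  apply: (@derive1_at_max _ g (- r) r) => //; first by rewrite ge0_cp // ltW.
    by move=> t /g0[].
  by move=> t tr; rewrite (g0 _ tr).2 (g0 _ I0).2.
have sx' t : `]-r, r[%classic t -> _ := fun tr => lie_derivative_along_solution s xf tr.
rewrite /zero_set /=; have := sx' _ I0; rewrite x0 => -[dR dI].
apply/eqP; rewrite eq_complex; apply/andP; split; apply/eqP.
  by apply: zero_deriv dR => t tr; have [[? _] _] := sx' t tr; rewrite sx.
by apply: zero_deriv dI => t tr; have [_ [? _]] := sx' t tr; rewrite sx.
Qed.

Theorem prime_invariantP (R : realType) n (f : vfield R[i] n) (s : {mpoly R[i][n]}) :
  prime_element s ->
  invariant_set f (zero_set s) <-> divides s (lie_derivative f s).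
Proof.
move=> sP; split; last exact: divides_invariant.
by move=> /invariant_lie_derivative0; exact: prime_hypersurface_null.
Qed.

(** * Regularity of beta and invariance of the factors *)

Theorem proposition6 (R : realType) (f g : vfield R[i] 2)
    (theta_neq0 : det_vf f g != 0)
    (r : nat) (sigma : 'I_r -> {mpoly R[i][2]}) (m : 'I_r -> nat)
    (sigma_prime : forall i, prime_element (sigma i))
    (sigma_coprime : forall i k, i != k ->
       relatively_prime (sigma i) (sigma k))
    (m_gt0 : forall i, (0 < m i)%N)
    (theta_fact : det_vf f g = \prod_(i < r) sigma i ^+ m i)
    (j : 'I_r) :
  (exists2 v : 'I_2 -> R[i],
     (zero_set (sigma j) `\` \bigcup_(i in [set i | i != j])
        zero_set (sigma i)) v
     & regular_at (beta f g) v)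
  <-> invariant_set f (zero_set (sigma j)).
Proof.
pose tau := \prod_(i < r | i != j) sigma i ^+ m i.
have thetaE : det_vf f g = sigma j ^+ m j * tau by rewrite theta_fact (bigD1 j).
have regularE v : (sigma j).@[v] = 0 -> tau.@[v] != 0 ->
    regular_at (beta f g) v <-> divides (sigma j) (lie_derivative f (sigma j)).
  move=> sv tv; rewrite /beta thetaE.
  exact: regular_logarithmic_derivative (pchar_num _) (m_gt0 j) (sigma_prime j) tv sv.
rewrite prime_invariantP //; split=> [[v [sv nsv] reg]|dvd].
  apply/(regularE v) => //; rewrite rmorph_prod /=; apply/prodf_neq0 => i ij.
  rewrite rmorphXn expf_neq0 //; apply/eqP => siv; apply: nsv.
  by exists i.
have [|v sv tv] := @prime_zero_off _ _ (sigma j) tau (sigma_prime j).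
  move=> /(prime_element_prod (sigma_prime j))[i ij].
  move=> /(prime_elementX (sigma_prime j)) ji.
  have [_ /negP + _] := sigma_prime j; apply.
  exact: sigma_coprime ij _ ji (divides_refl _).
exists v; last exact/(regularE v).
split=> // -[i ij siv]; move: tv; rewrite rmorph_prod => /prodf_neq0/(_ i ij).
by rewrite rmorphXn /= siv expr0n gtn_eqF ?eqxx.
Qed.
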